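(* Let $(\mathfrak g,[\cdot,\cdot]_{\mathfrak g},\rhd_{\mathfrak g})$ be a post-Lie algebra over $\mathbf k$. A pair $(\omega_0,\omega_1)$ with $\omega_0\in\mathrm{Hom}(\mathfrak g\wedge\mathfrak g,\mathfrak g)$ and $\omega_1\in\mathrm{Hom}(\mathfrak g\otimes\mathfrak g,\mathfrak g)$ determines an infinitesimal deformation of $(\mathfrak g,[\cdot,\cdot]_{\mathfrak g},\rhd_{\mathfrak g})$ (by $[\cdot,\cdot]_{\mathsf R}=[\cdot,\cdot]_{\mathfrak g}+t\omega_0$, $\rhd_{\mathsf R}=\rhd_{\mathfrak g}+t\omega_1$, $\mathsf R=\mathbf k[t]/(t^2)$) if and only if $(\omega_0,\omega_1)\in\mathfrak C^2(\mathfrak g;\mathfrak g)$ is a $2$-cocycle of the post-Lie algebra $(\mathfrak g,[\cdot,\cdot]_{\mathfrak g},\rhd_{\mathfrak g})$. Moreover, there is a one-to-one correspondence between equivalence classes of infinitesimal deformations of $(\mathfrak g,[\cdot,\cdot]_{\mathfrak g},\rhd_{\mathfrak g})$ and the second cohomology group $\mathcal H^2(\mathfrak g;\mathfrak g)$.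
   Context: The ground field $\mathbf k$ has characteristic zero. A post-Lie algebra $(\mathfrak g,[\cdot,\cdot]_{\mathfrak g},\rhd)$ is a Lie algebra $(\mathfrak g,[\cdot,\cdot]_{\mathfrak g})$ with a bilinear product $\rhd$ such that $x\rhd[y,z]_{\mathfrak g}=[x\rhd y,z]_{\mathfrak g}+[y,x\rhd z]_{\mathfrak g}$ and $([x,y]_{\mathfrak g}+x\rhd y-y\rhd x)\rhd z=x\rhd(y\rhd z)-y\rhd(x\rhd z)$. A homomorphism of post-Lie algebras is a Lie algebra homomorphism preserving $\rhd$. $\mathsf R$-post-Lie algebras and their homomorphisms, for a commutative $\mathbf k$-algebra $\mathsf R$, are defined in the same way with $\mathsf R$-modules and $\mathsf R$-(bi)linear maps. Infinitesimal deformations. Let $\mathsf R=\mathbf k[t]/(t^2)$ with augmentation $\epsilon:\mathsf R\to\mathbf k$, $t\mapsto 0$; $\mathfrak g$ is regarded as an $\mathsf R$-post-Lie algebra via $r\cdot x=\epsilon(r)x$. An infinitesimal deformation of $(\mathfrak g,[\cdot,\cdot]_{\mathfrak g},\rhd_{\mathfrak g})$ is an $\mathsf R$-post-Lie algebra structure $([\cdot,\cdot]_{\mathsf R},\rhd_{\mathsf R})$ on $\mathsf R\otimes\mathfrak g$ such that $\epsilon\otimes\mathrm{Id}_{\mathfrak g}:\mathsf R\otimes\mathfrak g\to\mathfrak g$ is a homomorphism of $\mathsf R$-post-Lie algebras. Every such structure has the form $[\cdot,\cdot]_{\mathfrak g}+t\omega_0$, $\rhd_{\mathfrak g}+t\omega_1$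 (extended $\mathsf R$-bilinearly). Two infinitesimal deformations $([\cdot,\cdot]_{\mathsf R},\rhd_{\mathsf R})$ and $([\cdot,\cdot]'_{\mathsf R},\rhd'_{\mathsf R})$ are equivalent if there is an isomorphism of $\mathsf R$-post-Lie algebras $\phi:(\mathsf R\otimes\mathfrak g,[\cdot,\cdot]'_{\mathsf R},\rhd'_{\mathsf R})\to(\mathsf R\otimes\mathfrak g,[\cdot,\cdot]_{\mathsf R},\rhd_{\mathsf R})$ with $(\epsilon\otimes\mathrm{Id}_{\mathfrak g})\circ\phi=\epsilon\otimes\mathrm{Id}_{\mathfrak g}$. Cohomology. Put $C_{\mathsf{PL}}^{n}(\mathfrak g,\mathfrak g)=\bigoplus_{i=0}^{n}\mathrm{Hom}(\wedge^{i}\mathfrak g\otimes \wedge^{n+1-i}\mathfrak g,\mathfrak g)$, with elements $f=(f_0,\dots,f_n)$. The space of $n$-cochains is $\mathfrak C^0(\mathfrak g;\mathfrak g)=0$, $\mathfrak C^n(\mathfrak g;\mathfrak g)=C_{\mathsf{PL}}^{n-1}(\mathfrak g,\mathfrak g)$ for $n\ge1$; the coboundary operator is $\partial(f)=(-1)^{n-1}[\pi,f]_{\mathsf{PL}}$ for $f\in\mathfrak C^n(\mathfrak g;\mathfrak g)$, where $\pi=([\cdot,\cdot]_{\mathfrak g},\rhd_{\mathfrak g})\in C^1_{\mathsf{PL}}(\mathfrak g,\mathfrak g)$ (it satisfies $\partial^2=0$). $\mathcal H^n(\mathfrak g;\mathfrak g)$ is the $n$-th cohomology group of $(\bigoplus_n\mathfrak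 C^n(\mathfrak g;\mathfrak g),\partial)$. Here $[f,g]_{\mathsf{PL}}=f\circ g-(-1)^{nm}g\circ f$ for $f\in C_{\mathsf{PL}}^{n}$, $g\in C_{\mathsf{PL}}^{m}$, with $f\circ g$ defined as follows ($\mathbb S_{(i_1,\dots,i_k)}$ is the set of $(i_1,\dots,i_k)$-shuffles, empty if some $i_r<0$; products in exterior powers are written by juxtaposition). For $0\le k\le m$, $$\begin{aligned}&(f\circ g)_k(x_1 \cdots x_{k}\otimes x_{k+1} \cdots x_{n+m+1})=\sum_{0\le j\le k}\ \sum_{\sigma\in\mathbb S_{(k-j,j)}}\ \sum_{\tau\in\mathbb S_{(m+1-j,n+j-k)}}(-1)^\sigma(-1)^\tau(-1)^{m(k-j)}\\ &f_{k-j}\big(x_{\sigma(1)} \cdots x_{\sigma(k-j)}\otimes g_{j}(x_{\sigma(k-j+1)} \cdots x_{\sigma(k)}\otimes x_{k+\tau(1)} \cdots x_{k+\tau(m+1-j)})\, x_{k+\tau(m+2-j)} \cdots x_{k+\tau(n+m+1-k)}\big),\end{aligned}$$ and for $m+1\le k\le m+n$, $$\begin{aligned}&(f\circ g)_{k}(x_1 \cdots x_k\otimes x_{k+1} \cdots x_{n+m+1})\\ =&\sum_{0\le j\le m}\ \sum_{\sigma\in \mathbb S_{(j,m+1-j,k-m-1)}}(-1)^{\sigma}f_{k-m}\big(g_{j}(x_{\sigma(1)} \cdots x_{\sigma(j)}\otimes x_{\sigma(j+1)} \cdots x_{\sigma(m+1)})\, x_{\sigma(m+2)} \cdots x_{\sigma(k)}\otimes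 x_{k+1} \cdots x_{n+m+1}\big)\\ &+\sum_{0\le j\le m}\ \sum_{\sigma\in\mathbb S_{(k-j,j)}}\ \sum_{\tau\in\mathbb S_{(m+1-j,n+j-k)}}(-1)^\sigma(-1)^\tau(-1)^{m(k-j)}\\ &f_{k-j}\big(x_{\sigma(1)} \cdots x_{\sigma(k-j)}\otimes g_{j}(x_{\sigma(k-j+1)} \cdots x_{\sigma(k)}\otimes x_{k+\tau(1)} \cdots x_{k+\tau(m+1-j)})\, x_{k+\tau(m+2-j)} \cdots x_{k+\tau(n+m+1-k)}\big).\end{aligned}$$ *)

(* Defs.v *)
From HB Require Import structures.
From mathcomp Require Import all_boot all_order all_fingroup all_algebra.
From mathcomp Require Import generic_quotient ring_quotient sesquilinear qpoly.
From mathcomp Require Import boolp functions zify.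

Set Implicit Arguments.
Unset Strict Implicit.
Unset Printing Implicit Defensive.

Import GRing.Theory.
Local Open Scope ring_scope.
Local Open Scope quotient_scope.

(** * Post-Lie algebras over a commutative ring *)

Record postLie (S : comNzRingType) (L : lmodType S) := PostLie {
  lbr : {bilinear L -> L -> L};
  rhd : {bilinear L -> L -> L};
  lbr_alt : forall x, lbr x x = 0;
  lbr_jacobi : forall x y z,
    lbr x (lbr y z) + lbr y (lbr z x) + lbr z (lbr x y) = 0;
  rhd_lbr : forall x y z,
    rhd x (lbr y z) = lbr (rhd x y) z + lbr y (rhd x z);
  rhd_rhd : forall x y z,
    rhd (lbr x y + rhd x y - rhd y x) z = rhd x (rhd y z) - rhd y (rhd x z)
}.

Definition postLie_hom (S : comNzRingType) (L M : lmodType S)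
    (A : postLie L) (B : postLie M) (phi : {linear L -> M}) : Prop :=
  (forall x y, phi (lbr A x y) = lbr B (phi x) (phi y)) /\
  (forall x y, phi (rhd A x y) = rhd B (phi x) (phi y)).

(** * Base change to [k[t]/(t^2)] *)

Notation dualnum k := {poly %/ ('X^2 : {poly k})}.

Section BaseChange.
Context (k : fieldType) (V : lmodType k).
Local Notation R := (dualnum k).

Definition tR : R := 'qX.

(* The augmentation sends [r] to its constant coefficient. *)
Definition eps (r : R) : k := (r : {poly k})`_0.

Lemma dual0 : eps 0 = 0 /\ (0 : R)`_1 = 0.
Proof. by rewrite /eps !coef0. Qed.

Lemma dualD (r s : R) :
  eps (r + s) = eps r + eps s /\ (r + s)`_1 = r`_1 + s`_1.
Proof. by rewrite /eps !coefD. Qed.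

Lemma dual1 : eps 1 = 1 /\ (1 : R)`_1 = 0.
Proof. by rewrite /eps !qpolyCE !coefC. Qed.

Lemma dualM (r s : R) :
  eps (r * s) = eps r * eps s /\ (r * s)`_1 = eps r * s`_1 + r`_1 * eps s.
Proof.
have E i : (i < 2)%N -> (r * s)`_i = ((r : {poly k}) * (s : {poly k}))`_i.
  move=> i2; rewrite poly_of_qpolyM; move: ((r : {poly k}) * _) => p.
  rewrite mk_monic_Xn [in RHS](Pdiv.RingMonic.rdivp_eq (monicXn _ 2) p).
  by rewrite coefD coefMXn i2 add0r.
rewrite /eps; split; rewrite E // coefM !big_ord_recl big_ord0 /= ?addr0 //.
Qed.

Lemma dual_t : eps tR = 0 /\ tR`_1 = 1.
Proof.
rewrite /eps /tR qpolyXE ?coefX ?eqxx //; first by rewrite size_polyXn.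
exact: monicXn.
Qed.

(* [R] is free over [k] with basis [1, t], so [R ⊗ V] is realised as
   [V * V], the pair [(x, y)] standing for [1 ⊗ x + t ⊗ y]; see [ext_univ]
   for the universal property of the tensor product. *)
Definition ext : Type := (V * V)%type.
HB.instance Definition _ := GRing.Zmodule.on ext.

Definition ext_scale (r : R) (u : ext) : ext :=
  (eps r *: u.1, eps r *: u.2 + r`_1 *: u.1).

Fact ext_scaleA r s u : ext_scale r (ext_scale s u) = ext_scale (r * s) u.
Proof.
have [e0 e1] := dualM r s; rewrite /ext_scale e0 e1 /= scalerA.
by rewrite scalerDr !scalerA scalerDl addrA.
Qed.
Fact ext_scale1 : left_id 1 ext_scale.
Proof.
have [e0 e1] := dual1.
by case=> x y; rewrite /ext_scale e0 e1 /= !scale1r scale0r addr0.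
Qed.
Fact ext_scaleDr : right_distributive ext_scale +%R.
Proof.
move=> r [x y] [x' y']; congr pair => /=; rewrite !scalerDr //.
by rewrite addrACA.
Qed.
Fact ext_scaleDl u : {morph ext_scale^~ u : r s / r + s}.
Proof.
move=> r s; have [e0 e1] := dualD r s; rewrite /ext_scale e0 e1 /= !scalerDl.
by congr pair => /=; rewrite addrACA.
Qed.
HB.instance Definition _ := GRing.Zmodule_isLmodule.Build R ext
  ext_scaleA ext_scale1 ext_scaleDr ext_scaleDl.

Definition tens (r : R) (x : V) : ext := (eps r *: x, r`_1 *: x).

Lemma scale_tens (r s : R) x : r *: tens s x = tens (r * s) x.
Proof.
have [e0 e1] := dualM r s.
by rewrite /tens e0 e1 /GRing.scale /= /ext_scale /= !scalerA -scalerDl.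
Qed.

Lemma ext_decomp (u : ext) : u = tens 1 u.1 + tens tR u.2.
Proof.
case: u => x y; have [e0 e1] := dual1; have [f0 f1] := dual_t.
rewrite /tens e0 e1 f0 f1 !scale0r !scale1r.
by congr pair; rewrite /= ?addr0 ?add0r.
Qed.

Lemma ext_univ (W : lmodType k) (b : R -> V -> W) :
  (forall x, linear (b^~ x)) -> (forall r, linear (b r)) ->
  exists! h : ext -> W,
    [/\ {morph h : u v / u + v},
        forall c u, h (qpolyC 'X^2 c *: u) = c *: h u &
        forall r x, h (tens r x) = b r x].
Proof.
move=> bl br; exists (fun u => b 1 u.1 + b tR u.2); split; last first.
  move=> h [hD _ hT]; apply/funext => u.
  by rewrite [in RHS](ext_decomp u) hD !hT.
have bD r x y : b r (x + y) = b r x + b r y.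
  by have := br r 1 x y; rewrite !scale1r.
have b0 r : b r 0 = 0 by have := bD r 0 0; rewrite addr0 => /eqP;
  rewrite -subr_eq0 opprD addNKr oppr_eq0 => /eqP.
have bZ r c x : b r (c *: x) = c *: b r x.
  by have := br r c x 0; rewrite addr0 b0 addr0.
have blZ r c x : b (c *: r) x = c *: b r x.
  have b00 : b 0 x = 0.
    have := bl x 1 0 0; rewrite !scale1r !addr0 => /eqP.
    by rewrite -subr_eq0 opprD addNKr oppr_eq0 => /eqP.
  by have := bl x c r 0; rewrite addr0 b00 addr0.
split.
- by move=> u v /=; rewrite !bD addrACA.
- move=> c [x y]; have -> : qpolyC 'X^2 c *: ((x, y) : ext) = (c *: x, c *: y).
    have -> : forall r (u : ext), r *: u = ext_scale r u by [].
    by rewrite /ext_scale /eps qpolyCE !coefC /= scale0r addr0.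
  by rewrite /= !bZ scalerDr.
- move=> r x; rewrite /= !bZ -!blZ.
  have := bl x 1 (eps r *: (1 : R)) (r`_1 *: tR).
  rewrite !scale1r => <-; congr (b _ x).
  apply/val_inj/polyP => i /=; rewrite coefD !coefZ.
  have [e0 e1] := dual1; have [f0 f1] := dual_t.
  case: i => [|[|i]]; first by rewrite [_`_0]e0 [_`_0]f0 mulr1 mulr0 addr0.
    by rewrite [_`_1]e1 [_`_1]f1 mulr1 mulr0 add0r.
  have big (s : R) : s`_i.+2 = 0.
    by rewrite big_coef_npoly // mk_monic_Xn size_polyXn.
  by rewrite [RHS]big [X in _ * X + _](big 1) [X in _ + _ * X](big tR) !mulr0 addr0.
Qed.

(* [V] with the [R]-module structure [r · x = eps r *: x]. *)
Definition epsmod : Type := V.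
HB.instance Definition _ := GRing.Zmodule.on epsmod.

Definition epsmod_scale (r : R) (x : epsmod) : epsmod := eps r *: (x : V).

Fact epsmod_scaleA r s x :
  epsmod_scale r (epsmod_scale s x) = epsmod_scale (r * s) x.
Proof. by rewrite /epsmod_scale (dualM r s).1 scalerA. Qed.
Fact epsmod_scale1 : left_id 1 epsmod_scale.
Proof. by move=> x; rewrite /epsmod_scale dual1.1 scale1r. Qed.
Fact epsmod_scaleDr : right_distributive epsmod_scale +%R.
Proof. by move=> r x y; rewrite /epsmod_scale scalerDr. Qed.
Fact epsmod_scaleDl x : {morph epsmod_scale^~ x : r s / r + s}.
Proof. by move=> r s; rewrite /epsmod_scale (dualD r s).1 scalerDl. Qed.
HB.instance Definition _ := GRing.Zmodule_isLmodule.Build R epsmod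
  epsmod_scaleA epsmod_scale1 epsmod_scaleDr epsmod_scaleDl.

(* The map [eps ⊗ Id]; see [epsId_tens]. *)
Definition epsId (u : ext) : epsmod := u.1.
Fact epsId_linear : linear epsId.
Proof. by []. Qed.
HB.instance Definition _ :=
  GRing.isLinear.Build R ext epsmod *:%R epsId epsId_linear.

Lemma epsId_tens r x : epsId (tens r x) = eps r *: x :> V.
Proof. by []. Qed.

Section Restrict.
Context (b : {bilinear V -> V -> V}).
Definition epsmod_bil (x y : epsmod) : epsmod := b x y.
Fact epsmod_bil_bilinear : bilinear_for *:%R *:%R epsmod_bil.
Proof.
split=> u r x y.
  exact: (linearPl b u (eps r) x y).
exact: (linearPr b u (eps r) x y).
Qed.
HB.instance Definition _ := bilinear_isBilinear.Build R epsmod epsmod epsmod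
  *:%R *:%R epsmod_bil epsmod_bil_bilinear.
End Restrict.

Definition epsmod_postLie (g : postLie V) : postLie epsmod :=
  @PostLie _ epsmod (epsmod_bil (lbr g)) (epsmod_bil (rhd g))
    (lbr_alt g) (lbr_jacobi g) (rhd_lbr g) (rhd_rhd g).

End BaseChange.

(** * Infinitesimal deformations *)

Section Deformation.
Context (k : fieldType) (V : lmodType k) (g : postLie V).

Record infdef := InfDef {
  infdef_postLie :> postLie (ext V);
  infdef_eps : postLie_hom infdef_postLie (epsmod_postLie g) (@epsId k V)
}.
HB.instance Definition _ := gen_eqMixin infdef.
HB.instance Definition _ := gen_choiceMixin infdef.

Definition infdef_equiv (D D' : infdef) : Prop :=
  exists phi : {linear ext V -> ext V},
    [/\ bijective phi, postLie_hom D' D phi & forall u, epsId (phi u) = epsId u].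

Fact infdef_equiv_refl D : infdef_equiv D D.
Proof. by exists idfun; split=> //; exists idfun. Qed.

Fact infdef_equiv_sym D D' : infdef_equiv D D' -> infdef_equiv D' D.
Proof.
case=> phi [bphi [hbr hrhd] heps]; have [psi phiK psiK] := bphi.
have psi_lin : linear psi.
  by move=> a u v; apply: (can_inj phiK); rewrite linearP !psiK.
pose psiL : {linear ext V -> ext V} := HB.pack psi
  (GRing.isLinear.Build _ (ext V) (ext V) *:%R psi psi_lin).
exists psiL; split; first by exists phi.
  by split=> u v; apply: (can_inj phiK) => /=; rewrite ?hbr ?hrhd !psiK.
by move=> u; rewrite -heps /= psiK.
Qed.

Fact infdef_equiv_trans D1 D2 D3 :
  infdef_equiv D1 D2 -> infdef_equiv D2 D3 -> infdef_equiv D1 D3.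
Proof.
case=> f [bf [f1 f2] fe] [h [bh [h1 h2] he]]; exists (f \o h); split.
- exact: bij_comp.
- by split=> u v /=; rewrite ?h1 ?h2 ?f1 ?f2.
- by move=> u /=; rewrite fe he.
Qed.

Definition infdef_equivb (D D' : infdef) : bool := `[< infdef_equiv D D' >].
Fact infdef_equivb_refl : reflexive infdef_equivb.
Proof. by move=> D; apply/asboolP/infdef_equiv_refl. Qed.
Fact infdef_equivb_sym : symmetric infdef_equivb.
Proof. by move=> D D'; apply/asboolP/asboolP => /infdef_equiv_sym. Qed.
Fact infdef_equivb_trans : transitive infdef_equivb.
Proof.
by move=> D D' D'' /asboolP h /asboolP /(infdef_equiv_trans h) /asboolP.
Qed.
Canonical infdef_equiv_rel := EquivRel infdef_equivb
  infdef_equivb_refl infdef_equivb_sym infdef_equivb_trans.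

Definition infdef_class : Type := {eq_quot infdef_equivb}.
HB.instance Definition _ := Choice.on infdef_class.
HB.instance Definition _ := EqQuotient.on infdef_class.

(* An [R]-bilinear operation on [R ⊗ V] is determined by its values on the
   elements [1 ⊗ x]. *)
Definition determines (w0 w1 : V -> V -> V) (D : infdef) : Prop :=
  (forall x y, lbr D (tens 1 x) (tens 1 y) =
     tens 1 (lbr g x y) + tens (tR k) (w0 x y)) /\
  (forall x y, rhd D (tens 1 x) (tens 1 y) =
     tens 1 (rhd g x y) + tens (tR k) (w1 x y)).

End Deformation.

(** * The cochain complex *)

(* The shuffles for blocks of sizes [s_0, s_1, ...]: the permutations that
   increase on every block of consecutive positions. *)
Definition shuffles (s : seq nat) : {set 'S_(sumn s)} :=
  [set p : 'S_(sumn s) | [forall a : 'I_(sumn s), forall b : 'I_(sumn s),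
     (a < b)%N && (reshape_index s a == reshape_index s b) ==> (p a < p b)%N]].

Section Cochains.
Context (k : fieldType) (V : lmodType k).

(* [f_0, ..., f_n], each a function of [n+1] arguments. *)
Definition opfamily n : Type := 'I_n.+1 -> n.+1.-tuple V -> V.
HB.instance Definition _ n := GRing.Zmodule.on (opfamily n).

(* [app f i s t] is [f_i] at the [n+1] arguments [s ++ t]; when [size s = i] it
   is [f_i (s ⊗ t)]. *)
Definition app n (f : opfamily n) (i : nat) (s t : seq V) : V :=
  f (inord i) [tuple (s ++ t)`_l | l < n.+1].

(* [f_i] in [Hom (∧^i V ⊗ ∧^(n+1-i) V, V)] is given as a multilinear map of
   [n+1] arguments, alternating in the first [i] and in the last [n+1-i]. *)
Definition multilinear n (f : opfamily n) : Prop :=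
  forall (i : 'I_n.+1) (c : k) (u v : V) (s t : seq V),
    (size s + size t = n)%N ->
    app f i s ((c *: u + v) :: t) =
      c *: app f i s (u :: t) + app f i s (v :: t).

Definition alternating n (f : opfamily n) : Prop :=
  forall (i : 'I_n.+1) (x : n.+1.-tuple V) (a b : 'I_n.+1),
    (a < b)%N -> (b < i)%N || (i <= a)%N -> tnth x a = tnth x b -> f i x = 0.

Definition is_PL n : {pred opfamily n} :=
  fun f => `[< multilinear f /\ alternating f >].

Lemma app0 n i s t : app (0 : opfamily n) i s t = 0. Proof. by []. Qed.
Lemma appB n (f h : opfamily n) i s t :
  app (f - h) i s t = app f i s t - app h i s t.
Proof. by []. Qed.

Fact is_PL_zmod_closed n : zmod_closed (@is_PL n).
Proof.
split=> [|f h /asboolP[fl fa] /asboolP[hl ha]]; apply/asboolP; split.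
- by move=> i c u v s t _; rewrite !app0 scaler0 addr0.
- by [].
- move=> i c u v s t st; rewrite !appB fl // hl // scalerBr opprD.
  by rewrite addrACA.
- move=> i x a b ab ib e; rewrite -[LHS]/(f i x - h i x).
  by rewrite (fa _ _ _ _ ab) // (ha _ _ _ _ ab) // subr0.
Qed.
HB.instance Definition _ n :=
  GRing.isZmodClosed.Build (opfamily n) (@is_PL n) (is_PL_zmod_closed n).

Record CPL n : Type := MkCPL { cpl :> opfamily n; _ : cpl \in @is_PL n }.
HB.instance Definition _ n := [isSub for @cpl n].
HB.instance Definition _ n := [Choice of CPL n by <:].
HB.instance Definition _ n := [SubChoice_isSubZmodule of CPL n by <:].

(* The sequence [x_(p 1), x_(p 2), ...]. *)
Definition permute (s : seq nat) (p : 'S_(sumn s)) (x : seq V) : seq V :=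
  [seq x`_(p l) | l : 'I_(sumn s)].

(* [circ f h i x] is [(f ∘ h)_i (x)]: [circ2 f h J i x] is the sum over
   [0 <= j <= J] for [h] inserted in the second block of [f], where the guard
   discards the [j] with [n + j - i < 0], and [circ1 f h i x] is the sum for
   [h] inserted in the first block. *)
Definition circ2 n m (f : opfamily n) (h : opfamily m) (J i : nat) (x : seq V) : V :=
  \sum_(0 <= j < J.+1 | (i <= n + j)%N)
   \sum_(p in shuffles [:: i - j; j]%N)
    \sum_(q in shuffles [:: m.+1 - j; n + j - i]%N)
     let y := permute p (take i x) in
     let z := permute q (drop i x) in
     ((-1) ^+ p * (-1) ^+ q * (-1) ^+ (m * (i - j))) *:
       app f (i - j) (take (i - j) y)
         (app h j (drop (i - j) y) (take (m.+1 - j) z) :: drop (m.+1 - j) z).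

Definition circ1 n m (f : opfamily n) (h : opfamily m) (i : nat) (x : seq V) : V :=
  \sum_(0 <= j < m.+1)
   \sum_(p in shuffles [:: j; m.+1 - j; i - m.+1]%N)
     let y := permute p (take i x) in
     (-1) ^+ p *:
       app f (i - m)
         (app h j (take j y) (drop j (take m.+1 y)) :: drop m.+1 y)
         (drop i x).

Definition circ n m (f : opfamily n) (h : opfamily m) (i : nat) (x : seq V) : V :=
  if (i <= m)%N then circ2 f h i i x
  else circ1 f h i x + circ2 f h m i x.

Definition bracketPL n m (f : opfamily n) (h : opfamily m) : opfamily (n + m) :=
  fun i x => circ f h i x - (-1) ^+ (n * m) *: circ h f i x.

Definition pair_family (w0 w1 : V -> V -> V) : opfamily 1 :=
  fun i x => (if i == ord0 then w0 else w1) (tnth x ord0) (tnth x ord_max).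

Fact pair_family_is_PL (w0 w1 : {bilinear V -> V -> V}) :
  (forall x, w0 x x = 0) -> pair_family w0 w1 \in @is_PL 1.
Proof.
move=> w0_alt; apply/asboolP; split.
  move=> i c u v [|a [|a' s]] [|b [|b' t]] //= _;
    rewrite /app /pair_family !tnth_mktuple /=;
    by case: ifP => _; rewrite ?linearPl ?linearPr.
move=> [[|[|i]] //= hi] x [[|[|a]] //= ha] [[|[|b]] //= hb] //= _ _ e.
rewrite /pair_family -[LHS]/(w0 (tnth x _) (tnth x _)).
rewrite (_ : ord0 = Ordinal ha); last exact: val_inj.
by rewrite (_ : ord_max = Ordinal hb) ?e //; exact: val_inj.
Qed.

Definition pair_cochain (w0 w1 : {bilinear V -> V -> V})
    (w0_alt : forall x, w0 x x = 0) : CPL 1 :=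
  MkCPL (pair_family_is_PL w1 w0_alt).

Lemma appBr n (f : opfamily n) (i : nat) (u v : V) (s t : seq V) :
  multilinear f -> (size s + size t = n)%N ->
  app f i s ((u - v) :: t) = app f i s (u :: t) - app f i s (v :: t).
Proof.
move=> fl st; have := fl (inord i) (-1) v u s t st.
by rewrite /app inord_val scaleN1r [- v + u]addrC scaleN1r => ->; rewrite addrC.
Qed.

Lemma size_permute s (p : 'S_(sumn s)) x : size (permute p x) = sumn s.
Proof. by rewrite size_map -cardE card_ord. Qed.

Lemma circBl n m (f f' : opfamily n) (h : opfamily m) i x :
  circ (f - f') h i x = circ f h i x - circ f' h i x.
Proof.
have E2 J : circ2 (f - f') h J i x = circ2 f h J i x - circ2 f' h J i x.
  rewrite /circ2 -sumrB; apply: eq_bigr => j _.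
  rewrite -sumrB; apply: eq_bigr => p _; rewrite -sumrB; apply: eq_bigr => q _.
  by rewrite appB scalerBr.
rewrite /circ; case: ifP => _; rewrite E2 // opprD addrACA; congr (_ + _).
rewrite /circ1 -sumrB; apply: eq_bigr => j _.
by rewrite -sumrB; apply: eq_bigr => p _; rewrite appB scalerBr.
Qed.

Lemma circBr n m (f : opfamily n) (h h' : opfamily m) i x :
  multilinear f -> size x = (n + m).+1 -> (i <= n + m)%N ->
  circ f (h - h') i x = circ f h i x - circ f h' i x.
Proof.
move=> fl sx ix; have E2 J : (J <= i)%N -> (J <= m)%N ->
    circ2 f (h - h') J i x = circ2 f h J i x - circ2 f h' J i x.
  move=> Ji Jm; rewrite /circ2 -sumrB !big_mkord; apply: eq_bigr => j ij.
  have jJ : (j <= J)%N by rewrite -ltnS.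
  rewrite -sumrB; apply: eq_bigr => p _; rewrite -sumrB; apply: eq_bigr => q _.
  rewrite appB appBr ?scalerBr //.
  rewrite size_takel ?size_drop !size_permute /= ?addn0 ?leq_addr //.
  by lia.
rewrite /circ; case: ifP => im; first exact: E2.
rewrite E2 //; last by lia.
rewrite opprD addrACA; congr (_ + _).
rewrite /circ1 -sumrB !big_mkord; apply: eq_bigr => j _.
rewrite -sumrB; apply: eq_bigr => p _.
rewrite appB.
have appE u s t : app f (i - m) (u :: s) t = app f (i - m) [::] (u :: (s ++ t)).
  by [].
rewrite !appE appBr ?scalerBr //= size_cat !size_drop size_permute /=.
by have := ltn_ord j; lia.
Qed.

End Cochains.
Arguments pair_cochain {k V} w0 w1 w0_alt.

Section Cohomology.
Context (k : fieldType) (V : lmodType k) (g : postLie V).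

Definition postLie_cochain : CPL V 1 := pair_cochain (lbr g) (rhd g) (lbr_alt g).

(* [∂ f] for [f] in [ℭ^(n+1) = C_PL^n], where [(-1)^((n+1)-1) = (-1)^n]. *)
Definition coboundary n (f : CPL V n) : opfamily V n.+1 :=
  fun i x => (-1) ^+ n *: bracketPL postLie_cochain f i x.

Fact coboundaryB n (f h : CPL V n) :
  coboundary (f - h) = coboundary f - coboundary h.
Proof.
have [pl _] := asboolW (valP postLie_cochain).
apply/funext => i; apply/funext => x.
rewrite -[RHS]/(coboundary f i x - coboundary h i x) -scalerBr.
congr (_ *: _); rewrite /bracketPL circBl circBr ?size_tuple //; last first.
  exact: (ltn_ord i).
by rewrite scalerBr !opprB addrACA [RHS]addrACA [in RHS](addrC (- _)).
Qed.

Fact coboundary0 n : coboundary (0 : CPL V n) = 0.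
Proof. by rewrite -(subrr 0) coboundaryB subrr. Qed.

Definition is_cocycle n : {pred CPL V n} := fun f => coboundary f == 0.
Fact is_cocycle_zmod_closed n : zmod_closed (@is_cocycle n).
Proof.
split=> [|f h /eqP ef /eqP eh]; apply/eqP; first exact: coboundary0.
by rewrite coboundaryB ef eh subrr.
Qed.
HB.instance Definition _ n :=
  GRing.isZmodClosed.Build (CPL V n) (@is_cocycle n) (is_cocycle_zmod_closed n).

Record cocycle n : Type := MkCocycle {
  cocycle_cochain :> CPL V n; _ : cocycle_cochain \in @is_cocycle n }.
HB.instance Definition _ n := [isSub for @cocycle_cochain n].
HB.instance Definition _ n := [Choice of cocycle n by <:].
HB.instance Definition _ n := [SubChoice_isSubZmodule of cocycle n by <:].

(* The cocycles of type [cocycle n] live in [ℭ^(n+1)]; since [ℭ^0 = 0], the only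
   coboundary in [ℭ^1] is [0]. *)
Definition is_coboundary n : {pred cocycle n} :=
  match n return {pred cocycle n} with
  | 0 => fun f => f == 0
  | n'.+1 => fun f =>
      `[< exists h : CPL V n', coboundary h = f :> opfamily V n'.+1 >]
  end.
Fact is_coboundary_zmod_closed n : zmod_closed (@is_coboundary n).
Proof.
case: n => [|n]; split.
- exact: eqxx.
- by move=> f h /eqP -> /eqP ->; rewrite subr0; exact: eqxx.
- by apply/asboolP; exists 0; exact: coboundary0.
- move=> f h /asboolP[f' ef] /asboolP[h' eh]; apply/asboolP.
  by exists (f' - h'); rewrite coboundaryB ef eh.
Qed.
HB.instance Definition _ n := GRing.isZmodClosed.Build (cocycle n)
  (@is_coboundary n) (is_coboundary_zmod_closed n).

(* The group [H^n(g; g)]. *)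
Definition cohomology (n : nat) : zmodType :=
  if n is n'.+1 then Quotient.quot (@is_coboundary n') else 'rV[k]_0.

Definition cohomology_class n (z : cocycle n) : cohomology n.+1 :=
  \pi_(Quotient.quot (@is_coboundary n)) z.

End Cohomology.

Arguments is_cocycle {k V} g n _.

(* Main.v *)
(* On R (x) V = V + tV, the bracket [B + t w0] and the product [T + t w1]
   satisfy the post-Lie axioms iff the coefficients of t do; since t^2 = 0 these
   are three identities linear in (w0, w1), and they are the three components
   of [pi, (w0, w1)]_PL = 0.  An equivalence that reduces to the identity mod t
   has the form 1 + tN, and transporting a deformation along it changes
   (w0, w1) by the coboundary of N. *)
Require Import Defs.
From HB Require Import structures.
From mathcomp Require Import all_boot all_order all_fingroup all_algebra.
From mathcomp Require Import generic_quotient ring_quotient sesquilinear qpoly.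
From mathcomp Require Import boolp functions.

Set Implicit Arguments.
Unset Strict Implicit.
Unset Printing Implicit Defensive.

Import GRing.Theory.
Local Open Scope ring_scope.
Local Open Scope quotient_scope.

(** * Equalities valid in every abelian group *)

(** Syntax for a proof by reflection: two expressions agree in every abelian group once each atom
    has the same integer coefficient in both. *)
Inductive zexpr := ZVar of nat | ZZero | ZAdd of zexpr & zexpr | ZOpp of zexpr.

Fixpoint zeval (U : zmodType) (env : seq U) (e : zexpr) : U :=
  match e with
  | ZVar i => env`_i
  | ZZero => 0
  | ZAdd e1 e2 => zeval env e1 + zeval env e2
  | ZOpp e1 => - zeval env e1
  end.

Fixpoint zcoef (e : zexpr) (i : nat) : int :=
  match e with
  | ZVar j => (i == j)%:R
  | ZZero => 0
  | ZAdd e1 e2 => zcoef e1 i + zcoef e2 i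
  | ZOpp e1 => - zcoef e1 i
  end.

Lemma zevalE (U : zmodType) (env : seq U) e :
  zeval env e = \sum_(i < size env) env`_i *~ zcoef e i.
Proof.
elim: e => [j||e1 IH1 e2 IH2|e1 IH1] /=.
- have [js|js] := ltnP j (size env).
    rewrite (bigD1 (Ordinal js)) //= eqxx mulr1z big1 ?addr0 // => i ij.
    by rewrite -val_eqE /= in ij; rewrite (negPf ij) mulr0z.
  (* A variable outside [env] evaluates to the default 0, and no index of the sum meets it. *)
  rewrite nth_default // big1 // => i _.
  by rewrite ltn_eqF ?mulr0z // (leq_trans (ltn_ord i)).
- by rewrite big1 // => i _; rewrite mulr0z.
- by rewrite IH1 IH2 -big_split; apply: eq_bigr => i _; rewrite mulrzDr.
- by rewrite IH1 -sumrN; apply: eq_bigr => i _; rewrite mulrNz.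
Qed.

Lemma zeval_eq (U : zmodType) (env : seq U) e1 e2 :
  all (fun i => zcoef e1 i == zcoef e2 i) (iota 0 (size env)) ->
  zeval env e1 = zeval env e2.
Proof.
move/allP => h; rewrite !zevalE; apply: eq_bigr => i _.
by rewrite (eqP (h i _)) // mem_iota /=.
Qed.

(* Atoms are compared up to conversion: two occurrences of the same bilinear
   map may carry different canonical structures on the same carrier. *)
Ltac zmod_index env t :=
  match env with
  | cons ?a _ => let _ := constr:(erefl t : t = a) in constr:(0%N)
  | cons _ ?env' => let i := zmod_index env' t in constr:(S i)
  end.

(** The match on [tt] serves for backtracking: an atom is added only when [zmod_index] fails to find
    it. *)
Ltac zmod_atoms env t :=
  match t with
  | GRing.add ?a ?b => let env := zmod_atoms env a in zmod_atoms env b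
  | GRing.opp ?a => zmod_atoms env a
  | GRing.zero => env
  | _ => match constr:(tt) with
         | _ => let _ := zmod_index env t in env
         | _ => constr:(t :: env)
         end
  end.

Ltac zmod_reify env t :=
  match t with
  | GRing.add ?a ?b =>
      let ea := zmod_reify env a in
      let eb := zmod_reify env b in constr:(ZAdd ea eb)
  | GRing.opp ?a => let ea := zmod_reify env a in constr:(ZOpp ea)
  | GRing.zero => constr:(ZZero)
  | _ => let i := zmod_index env t in constr:(ZVar i)
  end.

Ltac zmod :=
  match goal with
  | |- @eq ?U ?a ?b =>
      let env := zmod_atoms (@nil U) a in
      let env := zmod_atoms env b in
      let ea := zmod_reify env a in
      let eb := zmod_reify env b in
      exact (@zeval_eq _ env ea eb isT)
  end.

(** * Low-degree components of the circle product *)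

(** A permutation of n+1 points is given by the image i of 0 and a permutation of the rest;
    injectivity suffices because (n+1)! = (n+1) n!. Iterating it lists S_2 and S_3. *)
Lemma sum_perm_recl (V : nmodType) n (F : 'S_n.+1 -> V) :
  \sum_p F p = \sum_i \sum_p F (lift_perm ord0 i p).
Proof.
rewrite pair_bigA /= (reindex (fun z => lift_perm ord0 z.1 z.2)) //=.
apply/onW_bij/inj_card_bij; last by rewrite card_prod card_ord !card_Sn factS.
move=> [i p] [j q] /= e.
have eij : i = j by have := lift_perm_id ord0 i p; rewrite e lift_perm_id.
rewrite -{j}eij in e *; congr pair; apply/permP => a; apply: (@lift_inj _ i).
by rewrite -!(lift_perm_lift ord0) e.
Qed.

Lemma sum_perm0 (V : nmodType) (F : 'S_0 -> V) : \sum_p F p = F 1%g.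
Proof. by apply: big_pred1 => p; apply/esym/eqP/permP; case. Qed.

Lemma forall_ord_recl n (P : pred 'I_n.+1) :
  [forall i, P i] = P ord0 && [forall i, P (lift ord0 i)].
Proof.
apply/forallP/andP => [h|[h0 /forallP h] i]; first by split=> //; apply/forallP.
by case: (unliftP ord0 i) => [j|] ->.
Qed.

Lemma forall_ord0 (P : pred 'I_0) : [forall i, P i].
Proof. by apply/forallP; case. Qed.

Section Cochains.
Context (k : fieldType) (V : lmodType k).

(** * Sums over shuffles of at most three positions *)

Lemma sum_shuffles_le1 (s : seq nat) (F : 'S_(sumn s) -> V) :
  (sumn s <= 1)%N -> \sum_(p in shuffles s) F p = F 1%g.
Proof.
move=> s1; apply: big_pred1 => p.
have eq_ord (a b : 'I_(sumn s)) : a = b.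
  apply: val_inj => /=; have := leq_trans (ltn_ord a) s1.
  by have := leq_trans (ltn_ord b) s1; rewrite !ltnS !leqn0 => /eqP -> /eqP ->.
have -> : p = 1%g by apply/permP => a; apply: eq_ord.
rewrite /= eqxx inE; apply/forallP => a; apply/forallP => b.
by rewrite (eq_ord a b) ltnn.
Qed.

Lemma permute1 s (x : seq V) :
  size x = sumn s -> permute (1%g : 'S_(sumn s)) x = x.
Proof.
move=> sx; apply: (@eq_from_nth _ 0) => [|i]; rewrite size_permute // => si.
rewrite (nth_map (Ordinal si)) -?cardE ?card_ord // perm1.
by rewrite [X in x`_X](nth_enum_ord (Ordinal si)).
Qed.

Lemma enum_I2 : enum 'I_2 = [:: ord0; lift ord0 ord0].
Proof. by rewrite !enum_ordSl (size0nil (size_enum_ord 0)). Qed.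

Lemma enum_I3 :
  enum 'I_3 = [:: ord0; lift ord0 ord0; lift ord0 (lift ord0 ord0)].
Proof. by rewrite enum_ordSl enum_I2. Qed.

(** A single non-empty block leaves only the identity. The summand is a function [F] of the parity
    and of the permuted sequence, since the sums in [circ] depend on a shuffle only through
    these. *)
Lemma sum_shuffles2 (F : bool -> seq V -> V) (s : seq nat) x y :
  s \in [:: [:: 2; 0]; [:: 0; 2; 0]] ->
  \sum_(p in shuffles s) F p (permute p [:: x; y]) = F false [:: x; y].
Proof.
rewrite big_mkcond; rewrite !inE => /orP[] /eqP ->;
  rewrite !(@sum_perm_recl V 1) !big_ord_recl !big_ord0;
  rewrite !(@sum_perm_recl V 0) !big_ord_recl !big_ord0 !sum_perm0 !inE;
  do !rewrite ?(@forall_ord_recl 1) ?(@forall_ord_recl 0) ?forall_ord0 /=;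
  rewrite ?(lift_perm_id, lift_perm_lift) /= ?addr0 !odd_lift_perm odd_perm1;
  rewrite /permute /image_mem [enum _]enum_I2 /=;
  by rewrite !(lift_perm_id, lift_perm_lift).
Qed.

Lemma sum_shuffles11 (F : bool -> seq V -> V) (s : seq nat) x y :
  s \in [:: [:: 1; 1]; [:: 1; 1; 0]] ->
  \sum_(p in shuffles s) F p (permute p [:: x; y]) =
    F false [:: x; y] + F true [:: y; x].
Proof.
rewrite big_mkcond; rewrite !inE => /orP[] /eqP ->;
  rewrite !(@sum_perm_recl V 1) !big_ord_recl !big_ord0;
  rewrite !(@sum_perm_recl V 0) !big_ord_recl !big_ord0 !sum_perm0 !inE;
  do !rewrite ?(@forall_ord_recl 1) ?(@forall_ord_recl 0) ?forall_ord0 /=;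
  rewrite ?(lift_perm_id, lift_perm_lift) /= ?addr0 !odd_lift_perm odd_perm1;
  rewrite /permute /image_mem [enum _]enum_I2 /=;
  by rewrite !(lift_perm_id, lift_perm_lift).
Qed.

(** The (2,1)-shuffles are the identity, a transposition and a 3-cycle, whence the signs +, -, +. *)
Lemma sum_shuffles21 (F : bool -> seq V -> V) x y z :
  \sum_(p in shuffles [:: 2; 1]) F p (permute p [:: x; y; z]) =
    F false [:: x; y; z] + F true [:: x; z; y] + F false [:: y; z; x].
Proof.
rewrite big_mkcond (@sum_perm_recl V 2) !big_ord_recl big_ord0.
rewrite !sum_perm_recl !big_ord_recl !big_ord0.
rewrite !sum_perm_recl !big_ord_recl !big_ord0 !sum_perm0 !inE.
do !rewrite ?(@forall_ord_recl 2) ?(@forall_ord_recl 1) ?(@forall_ord_recl 0).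
rewrite !forall_ord0 /= !(lift_perm_id, lift_perm_lift) /=.
rewrite ?(lift_perm_id, lift_perm_lift) /= ?addr0 ?add0r.
rewrite !odd_lift_perm odd_perm1 /permute /image_mem [enum _]enum_I3 /=.
by do !rewrite !(lift_perm_id, lift_perm_lift) /=.
Qed.

(** * Circle product of two elements of C_PL^1 *)

Lemma circ11_0 (f h : opfamily V 1) x y z :
  circ f h 0 [:: x; y; z] =
    app f 0 [::] [:: app h 0 [::] [:: x; y]; z]
    - app f 0 [::] [:: app h 0 [::] [:: x; z]; y]
    + app f 0 [::] [:: app h 0 [::] [:: y; z]; x].
Proof.
rewrite /circ /= /circ2 big_mkcond big_nat1.
rewrite sum_shuffles_le1 // permute1 //= odd_perm1.
rewrite (sum_shuffles21 (fun e s => ((-1) ^+ false * (-1) ^+ e *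
  (-1) ^+ (1 * (0 - 0))) *: app f (0 - 0) [::]
  (app h 0 [::] (take 2 s) :: drop 2 s))) /=.
by rewrite !(subnn, muln0, expr0, expr1, mulr1, mul1r, scale1r, scaleN1r).
Qed.

Lemma circ11_1 (f h : opfamily V 1) x y z :
  circ f h 1 [:: x; y; z] =
    - app f 1 [:: x] [:: app h 0 [::] [:: y; z]]
    + (app f 0 [::] [:: app h 1 [:: x] [:: y]; z]
    - app f 0 [::] [:: app h 1 [:: x] [:: z]; y]).
Proof.
rewrite /circ /= /circ2 big_mkcond big_nat_recl // big_nat1.
rewrite (sum_shuffles_le1 (s := [:: 1 - 0; 0]%N)) //.
rewrite (sum_shuffles_le1 (s := [:: 1 - 1; 1]%N)) //.
rewrite !permute1 //= !odd_perm1.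
(* The factor (-1)^(m(k-j)) is -1 for j = 0 and 1 for j = 1. *)
rewrite (sum_shuffles2 (s := [:: 2; 0])
  (fun e s => ((-1) ^+ false * (-1) ^+ e *
  (-1) ^+ (1 * (1 - 0))) *: app f (1 - 0) [:: x]
  (app h 0 [::] (take 2 s) :: drop 2 s))) //=.
rewrite (sum_shuffles11 (s := [:: 1; 1])
  (fun e s => ((-1) ^+ false * (-1) ^+ e *
  (-1) ^+ (1 * (1 - 1))) *: app f (1 - 1) [::]
  (app h 1 [:: x] (take 1 s) :: drop 1 s))) //=.
by rewrite !(subnn, muln0, expr0, expr1, mulr1, mul1r, scale1r, scaleN1r).
Qed.

Lemma circ11_2 (f h : opfamily V 1) x y z :
  circ f h 2 [:: x; y; z] =
    app f 1 [:: app h 0 [::] [:: x; y]] [:: z]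
    + (app f 1 [:: app h 1 [:: x] [:: y]] [:: z]
    - app f 1 [:: app h 1 [:: y] [:: x]] [:: z])
    + (app f 1 [:: y] [:: app h 1 [:: x] [:: z]]
    - app f 1 [:: x] [:: app h 1 [:: y] [:: z]]).
Proof.
rewrite /circ /= /circ1 big_nat_recl // big_nat1.
rewrite (sum_shuffles2 (s := [:: 0; 2; 0])
  (fun e s => (-1) ^+ e *: app f (2 - 1)
  (app h 0 (take 0 s) (drop 0 (take 2 s)) :: drop 2 s) [:: z])) //=.
rewrite (sum_shuffles11 (s := [:: 1; 1; 0])
  (fun e s => (-1) ^+ e *: app f (2 - 1)
  (app h 1 (take 1 s) (drop 1 (take 2 s)) :: drop 2 s) [:: z])) //=.
(* The guard removes j = 0, where a shuffle block would have size n + j - i = -1; only j = 1 is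
   left. *)
rewrite /circ2 big_mkcond big_nat_recl // big_nat1 /= add0r.
under eq_bigr => p _
  do rewrite (sum_shuffles_le1 (s := [:: 1; 0])) //= permute1 // odd_perm1.
rewrite (sum_shuffles11 (s := [:: 1; 1])
  (fun e s => ((-1) ^+ e * (-1) ^+ false *
  (-1) ^+ (1 * (2 - 1))) *: app f (2 - 1) (take 1 s)
  (app h 1 (drop 1 s) [:: z] :: [::]))) //=.
rewrite !(expr0, expr1, mulr1, mul1r, mulrNN, scale1r, scaleN1r).
by rewrite [X in _ + X]addrC.
Qed.

(** * Circle products of C_PL^1 with C_PL^0, in both orders *)

Lemma circ10_0 (f : opfamily V 1) (h : opfamily V 0) x y :
  circ f h 0 [:: x; y] =
    app f 0 [::] [:: app h 0 [::] [:: x]; y]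
    - app f 0 [::] [:: app h 0 [::] [:: y]; x].
Proof.
rewrite /circ /= /circ2 big_mkcond big_nat1.
rewrite sum_shuffles_le1 // permute1 //= odd_perm1.
rewrite (sum_shuffles11 (s := [:: 1; 1])
  (fun e s => ((-1) ^+ false * (-1) ^+ e *
  (-1) ^+ (0 * (0 - 0))) *: app f (0 - 0) [::]
  (app h 0 [::] (take 1 s) :: drop 1 s))) //=.
by rewrite !(mul0n, expr0, expr1, mulr1, mul1r, scale1r, scaleN1r).
Qed.

Lemma circ10_1 (f : opfamily V 1) (h : opfamily V 0) x y :
  circ f h 1 [:: x; y] =
    app f 1 [:: app h 0 [::] [:: x]] [:: y]
    + app f 1 [:: x] [:: app h 0 [::] [:: y]].
Proof.
rewrite /circ /= /circ1 big_nat1 sum_shuffles_le1 // permute1 //= odd_perm1.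
rewrite /circ2 big_mkcond big_nat1.
rewrite !sum_shuffles_le1 // !permute1 //= !odd_perm1.
by rewrite !(mul0n, expr0, expr1, mulr1, mul1r, scale1r, scaleN1r).
Qed.

Lemma circ01_0 (f : opfamily V 0) (h : opfamily V 1) x y :
  circ f h 0 [:: x; y] = app f 0 [::] [:: app h 0 [::] [:: x; y]].
Proof.
rewrite /circ /= /circ2 big_mkcond big_nat1.
rewrite sum_shuffles_le1 // permute1 //= odd_perm1.
rewrite (sum_shuffles2 (s := [:: 2; 0])
  (fun e s => ((-1) ^+ false * (-1) ^+ e *
  (-1) ^+ (1 * (0 - 0))) *: app f (0 - 0) [::]
  (app h 0 [::] (take 2 s) :: drop 2 s))) //=.
by rewrite !(muln0, expr0, mulr1, mul1r, scale1r).
Qed.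

Lemma circ01_1 (f : opfamily V 0) (h : opfamily V 1) x y :
  circ f h 1 [:: x; y] = app f 0 [::] [:: app h 1 [:: x] [:: y]].
Proof.
rewrite /circ /= /circ2 big_mkcond big_nat_recl // big_nat1 /= add0r.
rewrite (sum_shuffles_le1 (s := [:: 0; 1])) //.
rewrite (sum_shuffles_le1 (s := [:: 1; 0])) //.
rewrite !permute1 //= !odd_perm1.
by rewrite !(muln0, expr0, mulr1, mul1r, scale1r).
Qed.

Lemma app_pair0 (w0 w1 : V -> V -> V) s t :
  app (pair_family w0 w1) 0 s t = w0 (s ++ t)`_0 (s ++ t)`_1.
Proof. by rewrite /app /pair_family -val_eqE /= inordK // !tnth_mktuple. Qed.

Lemma app_pair1 (w0 w1 : V -> V -> V) s t :
  app (pair_family w0 w1) 1 s t = w1 (s ++ t)`_0 (s ++ t)`_1.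
Proof. by rewrite /app /pair_family -val_eqE /= inordK // !tnth_mktuple. Qed.

Lemma alternating_skew (w : {bilinear V -> V -> V}) :
  (forall x, w x x = 0) -> forall x y, w y x = - w x y.
Proof.
move=> w_alt x y; apply/eqP; rewrite -addr_eq0.
by have := w_alt (x + y); rewrite linearDr !linearDl !w_alt add0r addr0 => /eqP.
Qed.

End Cochains.

(** * Low-degree coboundaries *)

Section Deformation.
Context (k : fieldType) (V : lmodType k) (g : postLie V).
Local Notation B := (lbr g).
Local Notation T := (rhd g).

(* The coefficient of [t] in the post-Lie axioms for [B + t w0], [T + t w1]. *)
Definition infinitesimal (w0 w1 : V -> V -> V) : Prop := forall x y z,
  [/\ B x (w0 y z) + w0 x (B y z) + (B y (w0 z x) + w0 y (B z x)) +
        (B z (w0 x y) + w0 z (B x y)) = 0,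
      T x (w0 y z) + w1 x (B y z) =
        B (w1 x y) z + w0 (T x y) z + (B y (w1 x z) + w0 y (T x z)) &
      T (w0 x y + w1 x y - w1 y x) z + w1 (B x y + T x y - T y x) z =
        T x (w1 y z) + w1 x (T y z) - (T y (w1 x z) + w1 y (T x z))].

(** For n = m = 1 both (-1)^n and (-1)^(nm) are -1, so the bracket with π becomes a symmetric
    sum. *)
Lemma coboundary1E (f : CPL V 1) (i : 'I_3) (x : 3.-tuple V) :
  coboundary g f i x =
  - (circ (postLie_cochain g) f i x + circ f (postLie_cochain g) i x).
Proof. by rewrite /coboundary /bracketPL !expr1 !scaleN1r opprK. Qed.

(** Components 0, 1, 2 of the coboundary are, up to sign, the t-coefficients of the Jacobi identity,
    of [rhd_lbr] and of [rhd_rhd]. *)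
Lemma is_cocycleP (w0 w1 : {bilinear V -> V -> V})
    (w0_alt : forall x, w0 x x = 0) :
  pair_cochain w0 w1 w0_alt \in is_cocycle g 1 <-> infinitesimal w0 w1.
Proof.
have Bs := alternating_skew (lbr_alt g).
have ws := alternating_skew w0_alt.
set f := pair_cochain _ _ _.
(* [d] is minus the coboundary, evaluated on three vectors. *)
pose d i x y z := circ (postLie_cochain g) f i [:: x; y; z] +
  circ f (postLie_cochain g) i [:: x; y; z].
have d0E x y z : d 0 x y z =
    - (B x (w0 y z) + w0 x (B y z) + (B y (w0 z x) + w0 y (B z x)) +
        (B z (w0 x y) + w0 z (B x y))).
  (* The circle product has the inner operation in the first slot, the Jacobi identity in the
     second; skew-symmetry of [B] and [w0] passes between the two. *)
  rewrite /d !circ11_0 /= !app_pair0 /= (Bs z (w0 x y)) (Bs x (w0 y z)).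
  rewrite (ws z (B x y)) (ws x (B y z)) (ws z x) (Bs z x).
  by rewrite !linearNl (Bs y (w0 z x)) (ws y (B z x)); zmod.
have d1E x y z : d 1 x y z =
    B (w1 x y) z + w0 (T x y) z + (B y (w1 x z) + w0 y (T x z)) -
      (T x (w0 y z) + w1 x (B y z)).
  rewrite /d !circ11_1 /= !app_pair0 !app_pair1 /=.
  by rewrite (Bs y (w1 x z)) (ws y (T x z)); zmod.
have d2E x y z : d 2 x y z =
    T (w0 x y + w1 x y - w1 y x) z + w1 (B x y + T x y - T y x) z -
      (T x (w1 y z) + w1 x (T y z) - (T y (w1 x z) + w1 y (T x z))).
  rewrite /d !circ11_2 /= !app_pair0 !app_pair1 /=.
  by rewrite !(linearDl, linearNl) /=; zmod.
have -> : f \in is_cocycle g 1 <->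
    forall (i : 'I_3) x y z, d i x y z = 0.
  split=> [/eqP df i x y z|df].
    have := congr1 (fun h : opfamily V 2 => h i [tuple x; y; z]) df.
    by rewrite coboundary1E => /eqP; rewrite oppr_eq0 => /eqP.
  apply/eqP/funext => i; apply/funext => t; rewrite coboundary1E.
  case/tupleP: t => x t; case/tupleP: t => y t; case/tupleP: t => z t.
  by rewrite (tuple0 t) -[circ _ _ _ _ + _]/(d i x y z) df oppr0.
split=> [df x y z|inf [[|[|[|i]]] // hi] x y z] /=; last first.
- by have [_ _ h] := inf x y z; rewrite d2E h subrr.
- by have [_ h _] := inf x y z; rewrite d1E h subrr.
- by have [h _ _] := inf x y z; rewrite d0E h oppr0.
split; apply/eqP.
- by have/eqP := df (Ordinal (isT : 0 < 3)%N) x y z; rewrite d0E oppr_eq0.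
- have/eqP := df (Ordinal (isT : 1 < 3)%N) x y z.
  by rewrite d1E subr_eq0 eq_sym.
- by have/eqP := df (Ordinal (isT : 2 < 3)%N) x y z; rewrite d2E subr_eq0.
Qed.

(** The coboundary of [h], read as an endomorphism N, measures how far N is from being a derivation
    of both operations. *)
Lemma coboundary0P (h : CPL V 0) (w0 w1 : V -> V -> V)
    (N := fun x => app h 0 [::] [:: x]) :
  coboundary g h = pair_family w0 w1 <->
  forall x y, w0 x y = B (N x) y + B x (N y) - N (B x y) /\
              w1 x y = T (N x) y + T x (N y) - N (T x y).
Proof.
have Bs := alternating_skew (lbr_alt g).
have d0 x y : coboundary g h ord0 [tuple x; y] =
    B (N x) y + B x (N y) - N (B x y).
  rewrite /coboundary /bracketPL !expr0 !scale1r circ10_0 circ01_0 /=.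
  by rewrite !app_pair0 /= (Bs x (N y)) opprK.
have d1 x y : coboundary g h ord_max [tuple x; y] =
    T (N x) y + T x (N y) - N (T x y).
  rewrite /coboundary /bracketPL !expr0 !scale1r circ10_1 circ01_1 /=.
  by rewrite !app_pair1.
split=> [dh x y|e].
  by rewrite -d0 -d1 dh.
apply/funext => i; apply/funext => t.
case/tupleP: t => x t; case/tupleP: t => y t; rewrite (tuple0 t).
have [e0 e1] := e x y.
case: (unliftP ord0 i) => [j|] ->.
  rewrite (ord1 j) (_ : lift _ _ = ord_max); last exact: val_inj.
  by rewrite [LHS]d1 -e1.
by rewrite [LHS]d0 -e0.
Qed.

End Deformation.

(** * Bilinear operations on the base change *)

Section DualNumbers.
Context (k : fieldType) (V : lmodType k).
Local Notation R := (dualnum k).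

Lemma tens1E (x : V) : tens 1 x = (x, 0).
Proof. by have [e0 e1] := dual1 k; rewrite /tens e0 e1 scale1r scale0r. Qed.

Lemma tens_tE (x : V) : tens (tR k) x = (0, x).
Proof. by have [e0 e1] := dual_t k; rewrite /tens e0 e1 scale1r scale0r. Qed.

Lemma tens_pair (x y : V) : tens 1 x + tens (tR k) y = (x, y).
Proof. exact/esym/(ext_decomp (x, y)). Qed.

Lemma scale_t (u : ext V) : tR k *: u = ((0, u.1) : ext V).
Proof.
have [e0 e1] := dual_t k.
rewrite -[LHS]/(eps (tR k) *: u.1, eps (tR k) *: u.2 + (tR k)`_1 *: u.1).
by rewrite e0 e1 !scale0r add0r scale1r.
Qed.

(* The [R]-bilinear extension of [b + t w]. *)
Definition ext_op (b w : V -> V -> V) (u v : ext V) : ext V :=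
  (b u.1 v.1, b u.1 v.2 + b u.2 v.1 + w u.1 v.1).

Fact ext_op_bilinear (b w : {bilinear V -> V -> V}) :
  bilinear_for ( *:%R : R -> ext V -> ext V) *:%R (ext_op b w).
Proof.
split=> u r x y; congr pair => /=.
- by rewrite linearPl.
- by rewrite !(linearDl, linearZl_LR) /= !scalerDr; zmod.
- by rewrite linearPr.
- by rewrite !(linearDr, linearZr_LR) /= !scalerDr; zmod.
Qed.

(** Bilinearity over R reduces everything to elements 1 ⊗ x; the term in which both arguments carry
    t vanishes because t^2 = 0. *)
Lemma ext_bilinearE (b : {bilinear ext V -> ext V -> ext V})
    (b0 w : V -> V -> V) :
  (forall x y, b (tens 1 x) (tens 1 y) =
     tens 1 (b0 x y) + tens (tR k) (w x y)) ->
  forall u v, b u v = ext_op b0 w u v.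
Proof.
move=> bE [x x'] [y y'].
have tE (z : V) : tens (tR k) z = tR k *: tens 1 z by rewrite scale_tens mulr1.
rewrite [X in b X _]ext_decomp [X in b _ X]ext_decomp /= !tE.
rewrite !(linearDl, linearDr) /= !(linearZl_LR, linearZr_LR) /= !bE.
rewrite !tens1E !tens_tE !scale_t /=.
by congr pair => /=; zmod.
Qed.

(** Scalars of k act through constant polynomials; with [snd_linear] this extracts k-linear maps
    from R-linear ones. *)
Lemma tens1_linear (c : k) (x y : V) :
  tens 1 (c *: x + y) = qpolyC 'X^2 c *: tens 1 x + tens 1 y.
Proof.
have q0 : eps (qpolyC 'X^2 c) = c by rewrite /eps qpolyCE coefC.
have q1 : (qpolyC 'X^2 c)`_1 = 0 by rewrite qpolyCE coefC.
rewrite !tens1E.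
rewrite -[RHS]/(eps (qpolyC 'X^2 c) *: x + y,
  eps (qpolyC 'X^2 c) *: 0 + (qpolyC 'X^2 c)`_1 *: x + 0).
by rewrite q0 q1 scaler0 scale0r !addr0.
Qed.

Lemma snd_linear (c : k) (u v : ext V) :
  (qpolyC 'X^2 c *: u + v).2 = c *: u.2 + v.2.
Proof.
rewrite -[LHS]/(eps _ *: _ + _`_1 *: _ + _).
by rewrite /eps qpolyCE !coefC /= scale0r addr0.
Qed.

End DualNumbers.

Lemma bilinear_exists (S : nzRingType) (L : lmodType S) (f : L -> L -> L) :
  bilinear_for *:%R *:%R f ->
  exists b : {bilinear L -> L -> L}, forall x y, b x y = f x y.
Proof.
move=> f_bilinear.
pose b : {bilinear L -> L -> L} := HB.pack f
  (bilinear_isBilinear.Build S L L L *:%R *:%R f f_bilinear).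
by exists b.
Qed.

(** * Deformations and cocycles *)

Section InfinitesimalDeformations.
Context (k : fieldType) (V : lmodType k) (g : postLie V).
Local Notation R := (dualnum k).
Local Notation B := (lbr g).
Local Notation T := (rhd g).

Lemma determines_extE (w0 w1 : V -> V -> V) (D : infdef g) :
  determines w0 w1 D ->
  (forall u v, lbr D u v = ext_op B w0 u v) /\
  (forall u v, rhd D u v = ext_op T w1 u v).
Proof. by case=> /ext_bilinearE h0 /ext_bilinearE h1. Qed.

Lemma determines_alt (w0 w1 : V -> V -> V) (D : infdef g) :
  determines w0 w1 D -> forall x, w0 x x = 0.
Proof.
case=> h _ x; have := lbr_alt D (tens 1 x).
by rewrite h lbr_alt tens1E tens_tE => /(congr1 snd) /=; rewrite add0r.
Qed.

Lemma determines_infinitesimal (w0 w1 : V -> V -> V) (D : infdef g) :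
  determines w0 w1 D -> infinitesimal g w0 w1.
Proof.
move=> /determines_extE[h0 h1] x y z.
split.
- have := congr1 snd (lbr_jacobi D (tens 1 x) (tens 1 y) (tens 1 z)).
  rewrite !h0 !tens1E /ext_op /= !linear0l !linear0r !(add0r, addr0) => <-.
  by zmod.
- have := congr1 snd (rhd_lbr D (tens 1 x) (tens 1 y) (tens 1 z)).
  rewrite !(h0, h1) !tens1E /ext_op /= !linear0l !linear0r !(add0r, addr0).
  by [].
- have := congr1 snd (rhd_rhd D (tens 1 x) (tens 1 y) (tens 1 z)).
  rewrite !(h0, h1) !tens1E /ext_op /= !linear0l !linear0r !(add0r, addr0).
  by [].
Qed.

(** The first coordinate of each axiom in three variables is that axiom for [g]. The second is the
    identity in [infinitesimal] at (x, y, z) plus three instances of the axiom for [g], each with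
    one argument replaced by its t-part. *)
Lemma determines_exists (w0 w1 : {bilinear V -> V -> V}) :
  (forall x, w0 x x = 0) -> infinitesimal g w0 w1 ->
  exists D : infdef g, determines w0 w1 D.
Proof.
move=> w0_alt inf.
have Bs := alternating_skew (lbr_alt g).
pose br : {bilinear ext V -> ext V -> ext V} := HB.pack (ext_op B w0)
  (bilinear_isBilinear.Build R (ext V) (ext V) (ext V) *:%R *:%R
     (ext_op B w0) (ext_op_bilinear B w0)).
pose rh : {bilinear ext V -> ext V -> ext V} := HB.pack (ext_op T w1)
  (bilinear_isBilinear.Build R (ext V) (ext V) (ext V) *:%R *:%R
     (ext_op T w1) (ext_op_bilinear T w1)).
have br_alt u : br u u = 0.
  case: u => x x'; congr pair; rewrite /= ?lbr_alt //.
  by rewrite (Bs x x') w0_alt subrr addr0.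
have br_jacobi u v w : br u (br v w) + br v (br w u) + br w (br u v) = 0.
  case: u v w => [x x'] [y y'] [z z']; congr pair; first exact: lbr_jacobi.
  have [J _ _] := inf x y z.
  rewrite /= !linearDr /=; apply: (eq_trans _ J).
  (* The zeros added on the right are the three Jacobi sums with one primed argument. *)
  rewrite -[RHS]addr0 -(lbr_jacobi g x' y z) -[RHS]addr0 -(lbr_jacobi g x y' z).
  by rewrite -[RHS]addr0 -(lbr_jacobi g x y z'); zmod.
have rh_br u v w : rh u (br v w) = br (rh u v) w + br v (rh u w).
  case: u v w => [x x'] [y y'] [z z']; congr pair; first exact: rhd_lbr.
  have [_ J _] := inf x y z.
  rewrite /= !linearDr !linearDl /= !rhd_lbr.
  (* The left side of [J] is isolated; the other summands are the three derivation rules with one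
     primed argument, already expanded. *)
  transitivity (T x (w0 y z) + w1 x (B y z) + (B (T x y) z' + B y (T x z') +
    (B (T x y') z + B y' (T x z)) + (B (T x' y) z + B y (T x' z)))).
    by zmod.
  by rewrite J; zmod.
have rh_rh u v w :
    rh (br u v + rh u v - rh v u) w = rh u (rh v w) - rh v (rh u w).
  case: u v w => [x x'] [y y'] [z z']; congr pair; first exact: rhd_rhd.
  have [_ _ J] := inf x y z.
  rewrite /= !linearDr !linearDl /=.
  transitivity (T (w0 x y + w1 x y - w1 y x) z + w1 (B x y + T x y - T y x) z
    + T (B x y + T x y - T y x) z' + T (B x y' + T x y' - T y' x) z
    + T (B x' y + T x' y - T y x') z).
    by rewrite !(linearDl, linearNl) /=; zmod.
  by rewrite J !rhd_rhd; zmod.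
pose P := PostLie br_alt br_jacobi rh_br rh_rh.
have Peps : postLie_hom P (epsmod_postLie g) (@epsId k V) by [].
exists (InfDef Peps); split=> x y; rewrite /= !tens1E tens_tE;
  by congr pair; rewrite /= ?linear0l ?linear0r ?add0r ?addr0.
Qed.

(** Compatibility with the augmentation fixes the first coordinate of both operations on elements 1
    ⊗ x; the second coordinates serve as [w0] and [w1]. *)
Lemma determined (D : infdef g) :
  exists w0 w1 : {bilinear V -> V -> V}, determines w0 w1 D.
Proof.
have [h0 h1] := infdef_eps D.
have snd_bilinear (b : {bilinear ext V -> ext V -> ext V}) :
    bilinear_for *:%R *:%R (fun x y : V => (b (tens 1 x) (tens 1 y)).2).
  split=> u c x y; rewrite tens1_linear -snd_linear; congr (_.2).
    exact: linearPl.
  exact: linearPr.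
have [b0 b0E] := bilinear_exists (snd_bilinear (lbr D)).
have [b1 b1E] := bilinear_exists (snd_bilinear (rhd D)).
exists b0, b1; split=> x y; rewrite ?b0E ?b1E tens_pair.
  have := h0 (tens 1 x) (tens 1 y).
  by rewrite !tens1E; case: (lbr D _ _) => u v /= ->.
have := h1 (tens 1 x) (tens 1 y).
by rewrite !tens1E; case: (rhd D _ _) => u v /= ->.
Qed.

(** An R-linear map that is the identity modulo t is 1 + tN, with inverse 1 - tN. Since it goes from
    [D'] to [D], its t-coefficients give the primed maps minus the unprimed ones. *)
Lemma infdef_equivP (w0 w1 w0' w1' : V -> V -> V) (D D' : infdef g) :
  determines w0 w1 D -> determines w0' w1' D' ->
  infdef_equiv D D' <-> exists N : {linear V -> V}, forall x y,
    w0' x y - w0 x y = B (N x) y + B x (N y) - N (B x y) /\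
    w1' x y - w1 x y = T (N x) y + T x (N y) - N (T x y).
Proof.
move=> /determines_extE[h0 h1] /determines_extE[h0' h1']; split.
  case=> phi [_ [phi0 phi1] phi_eps].
  have [N phi_tens1] : exists N : {linear V -> V},
      forall x, phi (tens 1 x) = (x, N x).
    have N_linear : linear (fun x => (phi (tens 1 x)).2).
      by move=> c x y; rewrite tens1_linear linearP snd_linear.
    pose N : {linear V -> V} := HB.pack (fun x => (phi (tens 1 x)).2)
      (GRing.isLinear.Build k V V *:%R _ N_linear).
    exists N => x; rewrite [LHS]surjective_pairing; congr pair.
    by have := phi_eps (tens 1 x); rewrite [in RHS]tens1E.
  have phiE x y : phi (x, y) = (x, y + N x).
    have -> : (x, y) = tens 1 x + tR k *: tens 1 y.
      by rewrite scale_t !tens1E; congr pair => /=; zmod.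
    rewrite linearD linearZ /= scale_t !phi_tens1.
    by congr pair => /=; zmod.
  exists N => x y; have := phi0 (tens 1 x) (tens 1 y).
  have := phi1 (tens 1 x) (tens 1 y).
  rewrite h0 h1 h0' h1' !phi_tens1 !tens1E /ext_op /= !phiE.
  rewrite !linear0l !linear0r !(addr0, add0r).
  move=> /(congr1 snd) /= e1 /(congr1 snd) /= e0.
  split.
    (* Adding these terms clears the subtractions and produces the left side of [e0]. *)
    apply: (addIr (w0 x y + N (B x y))).
    transitivity (w0' x y + N (B x y)); first by zmod.
    by rewrite e0; zmod.
  apply: (addIr (w1 x y + N (T x y))).
  transitivity (w1' x y + N (T x y)); first by zmod.
  by rewrite e1; zmod.
case=> N NE.
have phi_linear : linear (fun u : ext V => (u.1, u.2 + N u.1) : ext V).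
  move=> r u v; congr pair => /=.
  by rewrite linearD linearZ /= scalerDr; zmod.
pose phi : {linear ext V -> ext V} := HB.pack
  (fun u : ext V => (u.1, u.2 + N u.1) : ext V)
  (GRing.isLinear.Build R (ext V) (ext V) *:%R _ phi_linear).
exists phi; split=> //.
  exists (fun u : ext V => (u.1, u.2 - N u.1)) => [[x y]|[x y]] /=.
    by rewrite addrK.
  by rewrite /phi /= subrK.
split=> u v; rewrite ?h0 ?h1 ?h0' ?h1'; congr pair => /=;
  rewrite !(linearDl, linearDr) /=.
  have [/eqP + _] := NE u.1 v.1; rewrite subr_eq => /eqP ->; zmod.
have [_ /eqP +] := NE u.1 v.1; rewrite subr_eq => /eqP ->; zmod.
Qed.

(** * Cochains of degrees 1 and 2 as linear and bilinear maps *)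

Lemma cochain_of_linear (N : {linear V -> V}) :
  exists h : CPL V 0, forall x, app h 0 [::] [:: x] = N x.
Proof.
pose f : opfamily V 0 := fun _ x => N (tnth x ord0).
have f_PL : f \in @is_PL k V 0.
  apply/asboolP; split; last by move=> i x [[|a] ha] [[|b] hb].
  move=> i c u v [|a s] [|b t] //= _.
  by rewrite /app /f !tnth_mktuple /= linearP.
by exists (MkCPL f_PL) => x; rewrite /app /f /= tnth_mktuple.
Qed.

Lemma linear_of_cochain (h : CPL V 0) :
  exists N : {linear V -> V}, forall x, N x = app h 0 [::] [:: x].
Proof.
have [h_lin _] := asboolW (valP h).
pose N : {linear V -> V} := HB.pack (fun x => app h 0 [::] [:: x])
  (GRing.isLinear.Build k V V *:%R _
     (fun c u v => h_lin ord0 c u v [::] [::] erefl)).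
by exists N.
Qed.

Lemma app_tuple n (f : opfamily V n) (i : 'I_n.+1) (x : n.+1.-tuple V) :
  app f i [::] x = f i x.
Proof.
rewrite /app inord_val; congr (f i _).
by apply: eq_from_tnth => l; rewrite tnth_mktuple (tnth_nth 0).
Qed.

(** For index 0 both arguments lie in the second exterior power, so they alternate; for index 1 each
    exterior power holds one argument, which leaves a bilinear map. *)
Lemma cochain1E (f : CPL V 1) :
  exists w0 w1 : {bilinear V -> V -> V},
    (forall x, w0 x x = 0) /\ f = pair_family w0 w1 :> opfamily V 1.
Proof.
have [f_lin f_alt] := asboolW (valP f).
have f_bilinear (i : 'I_2) :
    bilinear_for *:%R *:%R (fun x y => app f i [::] [:: x; y]).
  split=> u c x y; first exact: (f_lin i c x y [::] [:: u]).
  exact: (f_lin i c x y [:: u] [::]).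
have [w0 w0E] := bilinear_exists (f_bilinear ord0).
have [w1 w1E] := bilinear_exists (f_bilinear ord_max).
exists w0, w1; split=> [x|].
  rewrite w0E (app_tuple f ord0 [tuple x; x]).
  exact: (f_alt _ _ ord0 ord_max).
apply/funext => i; apply/funext => t.
case/tupleP: t => x t; case/tupleP: t => y t; rewrite (tuple0 t) /pair_family.
case: (unliftP ord0 i) => [j|] ->.
  rewrite (ord1 j) (_ : lift _ _ = ord_max); last exact: val_inj.
  by rewrite /= w1E (app_tuple f ord_max [tuple x; y]).
by rewrite /= w0E (app_tuple f ord0 [tuple x; y]).
Qed.

(** * Comparison of deformations and cocycles *)

Definition represents (D : infdef g) (z : cocycle g 1) : Prop :=
  exists w0 w1 : V -> V -> V,
    determines w0 w1 D /\ z = pair_family w0 w1 :> opfamily V 1.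

Lemma represented_by_cocycle (D : infdef g) : exists z, represents D z.
Proof.
have [w0 [w1 Dw]] := determined D.
have w_inf := determines_infinitesimal Dw.
have /is_cocycleP w_cocycle := w_inf.
by exists (MkCocycle (w_cocycle (determines_alt Dw))), w0, w1.
Qed.

Lemma cocycle_represents (z : cocycle g 1) : exists D, represents D z.
Proof.
have [w0 [w1 [w0_alt zE]]] := cochain1E z.
have z_cocycle : pair_cochain w0 w1 w0_alt \in is_cocycle g 1.
  rewrite (_ : pair_cochain _ _ _ = cocycle_cochain z); first exact: valP z.
  exact/val_inj/esym.
have [D Dw] := determines_exists w0_alt ((is_cocycleP _ _ _).1 z_cocycle).
by exists D, w0, w1.
Qed.

(** This equivalence yields at once the injectivity of the correspondence and its independence of
    the chosen representatives. *)
Lemma represents_equivP (D D' : infdef g) (z z' : cocycle g 1) :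
  represents D z -> represents D' z' ->
  infdef_equiv D D' <-> cohomology_class z = cohomology_class z'.
Proof.
move=> [w0 [w1 [Dw zE]]] [w0' [w1' [Dw' zE']]].
have zBE : z' - z = pair_family (fun x y => w0' x y - w0 x y)
    (fun x y => w1' x y - w1 x y) :> opfamily V 1.
  rewrite -[LHS]/((z' : opfamily V 1) - (z : opfamily V 1)) zE zE'.
  apply/funext => i; apply/funext => x.
  by rewrite -[LHS]/(pair_family w0' w1' i x - pair_family w0 w1 i x)
    /pair_family; case: ifP.
(* Equality in the quotient means that a difference is a coboundary; it is oriented as z' - z to
   match the map from [D'] to [D]. *)
have -> : (cohomology_class z = cohomology_class z') <->
    exists h : CPL V 0, coboundary g h = z' - z :> opfamily V 1.
  split=> [/esym/eqP|[h hE]].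
    by rewrite -Quotient.idealrBE => /asboolP.
  by apply/esym/eqP; rewrite -Quotient.idealrBE; apply/asboolP; exists h.
rewrite zBE; apply: (iff_trans (infdef_equivP Dw Dw')); split.
  move=> [N NE]; have [h hE] := cochain_of_linear N.
  by exists h; apply/coboundary0P => x y /=; rewrite !hE.
move=> [h /coboundary0P hE]; have [N NE] := linear_of_cochain h.
by exists N => x y; rewrite !NE.
Qed.

End InfinitesimalDeformations.

Theorem theorem3p13 (k : fieldType) (k_char0 : [pchar k] =i pred0)
    (V : lmodType k) (g : postLie V) :
  (forall (w0 w1 : {bilinear V -> V -> V}) (w0_alt : forall x, w0 x x = 0),
     (exists D : infdef g, determines w0 w1 D) <->
     pair_cochain w0 w1 w0_alt \in is_cocycle g 1) /\
  (exists Phi : infdef_class g -> cohomology g 2,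
     bijective Phi /\
     forall (D : infdef g) (w0 w1 : {bilinear V -> V -> V})
       (w0_alt : forall x, w0 x x = 0)
       (w_cocycle : pair_cochain w0 w1 w0_alt \in is_cocycle g 1),
       determines w0 w1 D ->
       Phi (\pi_(infdef_class g) D) =
         cohomology_class (MkCocycle w_cocycle)).
Proof.
split=> [w0 w1 w0_alt|].
  rewrite is_cocycleP; split=> [[D /determines_infinitesimal //]|].
  exact: determines_exists.
have [Z ZP] := boolp.choice (@represented_by_cocycle k V g).
have [W WP] := boolp.choice (@cocycle_represents k V g).
have equiv_repr D : infdef_equiv (repr (\pi_(infdef_class g) D)) D.
  by apply/asboolP/(@eqquotP _ _ (infdef_class g)); rewrite reprK.
(* A class q goes to the class of the cocycle chosen for its representative; the inverse uses the
   deformation chosen for the representative of a cohomology class. *)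
exists (fun q => cohomology_class (Z (repr q))); split.
  exists (fun c => \pi_(infdef_class g) (W (repr c))) => [q|c].
    rewrite -[RHS]reprK; apply/eqquotP/asboolP.
    apply/(represents_equivP (WP _) (ZP _)).
    by rewrite /cohomology_class reprK.
  rewrite -[RHS]reprK -[RHS]/(cohomology_class _).
  exact/(represents_equivP (ZP _) (WP _)).
move=> D w0 w1 w0_alt w_cocycle Dw.
(* The representative of the class of [D] is equivalent to [D], so its chosen cocycle is
   cohomologous to the given one. *)
apply/(represents_equivP (ZP _) _ ).1; last exact: equiv_repr.
by exists w0, w1.
Qed.
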